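(* Let $\alpha\in(0,1]$, and let $H_m^\alpha$ ($m=0,1,2,\dots$) be the conformable fractional Hermite polynomials. Let $H_m$ denote the classical (physicists') Hermite polynomials. Then, for $x>0$: (I) $H_m^\alpha(x)=H_m(x^\alpha)$ for all $m\ge0$; (II) $T_\alpha\big(H_m^\alpha\big)(x)=2m\alpha\,H_{m-1}^\alpha(x)$ for all $m\ge1$; (III) ${}^{(m)}T_\alpha\big(H_m^\alpha\big)(x)=2^m\,m!\,\alpha^m$ for all $m\ge0$; (IV) $H_{m+1}^\alpha(x)=2x^\alpha H_m^\alpha(x)-2m\,H_{m-1}^\alpha(x)$ for all $m\ge1$; (V) $H_{m+1}^\alpha(x)=2x^\alpha H_m^\alpha(x)-\alpha^{-1}T_\alpha\big(H_m^\alpha\big)(x)$ for all $m\ge0$; (VI) $H_m^\alpha(x)=(-\alpha^{-1})^m e^{x^{2\alpha}}\;{}^{(m)}T_\alpha\big(e^{-x^{2\alpha}}\big)$ for all $m\ge0$. Moreover, if $\alpha=\frac{1}{2j+1}$ with $j\in\mathbb{N}$, then for all integers $m,n\ge0$: (VII) $\displaystyle\int_{-\infty}^{\infty}H_m^\alpha(x)H_n^\alpha(x)e^{-x^{2\alpha}}\,d_\alpha(x)=0$ if $m\neq n$; (VIII) $\displaystyle\int_{-\infty}^{\infty}H_m^\alpha(x)H_n^\alpha(x)e^{-x^{2\alpha}}\,d_\alpha(x)=\frac1\alpha\,2^n\,n!\,\sqrt{\pi}$ if $m=n$.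
   Context: Conformable fractional derivative (base point $0$): for $\alpha\in(0,1]$ and $x>0$, $$(T_\alpha f)(x)=\lim_{\varepsilon\to0}\frac{f(x+\varepsilon x^{1-\alpha})-f(x)}{\varepsilon};$$ ${}^{(m)}T_\alpha$ denotes $T_\alpha$ applied $m$ times (with ${}^{(0)}T_\alpha$ the identity). Conformable fractional Hermite polynomials: these are the particular solutions of the conformable fractional Hermite equation ${}^{(2)}T_\alpha y-2\alpha x^\alpha T_\alpha y+2\alpha^2 m y=0$ ($m$ a nonnegative integer) given as follows. For $m$ even, $$H_m^\alpha(x)=(-2)^{m/2}(m-1)!!\left[1+\sum_{k=1}^{\infty}(-1)^k\frac{2^k\,m(m-2)\cdots(m-2k+2)}{(2k)!}\,x^{2k\alpha}\right],$$ which corresponds to the initial conditions $y(0)=(-2)^{m/2}(m-1)!!$, $T_\alpha y(0)=0$. For $m$ odd, $$H_m^\alpha(x)=-(-2)^{(m+1)/2}\,m!!\left[x^\alpha+\sum_{k=1}^{\infty}(-1)^k\frac{2^k\,(m-1)(m-3)\cdots(m-2k+1)}{(2k+1)!}\,x^{(2k+1)\alpha}\right],$$ which corresponds to $y(0)=0$, $T_\alpha y(0)=-\alpha(-2)^{(m+1)/2}m!!$. In both cases the sum has only finitely many nonzero terms. Here $r!!=r(r-2)\cdots3\cdot1$ for $r$ odd and positive, and $(-1)!!=1$. Classical Hermite polynomials: $H_m(u)=(-1)^m e^{u^2}\frac{d^m}{du^m}e^{-u^2}$. In (VII) and (VIII), $\alpha=\frac1{2j+1}$ and for $x<0$ the power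 $x^\alpha$ is the real $(2j+1)$-th root of $x$, with $x^{k\alpha}=(x^\alpha)^k$ for integers $k$; $H_m^\alpha(x)$ is given for all real $x$ by the same formulas. The conformable fractional integral is $\int f(x)\,d_\alpha(x)=\int f(x)\,x^{\alpha-1}\,dx$, where $x^{\alpha-1}=(x^\alpha)^{-2j}=|x|^{\alpha-1}$ for $x\ne0$. *)

(* Defs.v *)
From HB Require Import structures.
From mathcomp Require Import all_boot all_order all_algebra.
From mathcomp Require Import all_classical all_reals all_analysis.

Set Implicit Arguments.
Unset Strict Implicit.
Unset Printing Implicit Defensive.

Import Order.TTheory GRing.Theory Num.Theory.
Import numFieldNormedType.Exports.

Local Open Scope classical_set_scope.
Local Open Scope ring_scope.

Definition conf_quot (R : realType) (a : R) (f : R -> R) (x e : R) : R :=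
  (f (x + e * x `^ (1 - a)) - f x) / e.

(* Only meant for 0 < x; the limit then depends only on f near x, so the
   values of f on x <= 0 play no role. *)
Definition conf_derivable (R : realType) (a : R) (f : R -> R) (x : R) : Prop :=
  cvg (conf_quot a f x e @[e --> 0^']).

Definition conf_derive (R : realType) (a : R) (f : R -> R) (x : R) : R :=
  lim (conf_quot a f x e @[e --> 0^']).

Definition conf_deriven (R : realType) (a : R) (m : nat) (f : R -> R) :
  R -> R := iter m (conf_derive a) f.

(* [conf_deriven] is built from the total operator [lim], so the existence of
   all m successive limits on the half-line is a separate predicate. *)
Definition conf_nderivable (R : realType) (a : R) (m : nat) (f : R -> R) :
  Prop :=
  forall k : nat, (k < m)%N ->
  forall x : R, 0 < x -> conf_derivable a (conf_deriven a k f) x.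

(* x^(k a): the usual power for 0 <= x, and for x < 0 the k-th power of
   - |x|^a, which is the real (2j+1)-th root of x when a = 1/(2j+1)
   (see [conf_pow_root]).  For other a the negative branch has no meaning. *)
Definition conf_pow (R : realType) (a x : R) (k : nat) : R :=
  if 0 <= x then x `^ (k%:R * a) else (- (`|x| `^ a)) ^+ k.

Lemma conf_pow_root (R : realType) (j : nat) (x : R) :
  conf_pow ((2 * j + 1)%:R^-1) x 1 ^+ (2 * j + 1) = x.
Proof.
have nz : (2 * j + 1)%:R != 0 :> R by rewrite pnatr_eq0 addn1.
rewrite /conf_pow; case: ifPn => [x0|].
  by rewrite mul1r -powR_mulrn ?powR_ge0// -powRrM mulVf// powRr1.
rewrite -ltNge => x0.
rewrite expr1 exprNn -[X in _ * X]powR_mulrn ?powR_ge0// -powRrM mulVf//.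
rewrite powRr1// ltr0_norm// exprD exprM sqrrN expr1n expr1n mul1r expr1.
by rewrite mulN1r opprK.
Qed.

(* Since 0!! = 1, the value (-1)!! = 1 is obtained as [dfact 0.-1]. *)
Fixpoint dfact (n : nat) : nat :=
  match n with
  | 0 => 1
  | 1 => 1
  | (p.+1 as q).+1 => q.+1 * dfact p
  end.

Definition conf_hermite (R : realType) (a : R) (m : nat) (x : R) : R :=
  if odd m then
    - ((-2) ^+ m.+1./2 * (dfact m)%:R *
       (conf_pow a x 1 +
        \big[+%R/0]_(1 <= k <oo)
          ((-1) ^+ k *
           (2 ^+ k * (\prod_(0 <= i < k) (m%:R - 1 - 2 * i%:R)) /
            ((2 * k + 1)`!)%:R) *
           conf_pow a x (2 * k + 1))))
  else
    (-2) ^+ m./2 * (dfact m.-1)%:R *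
    (1 +
     \big[+%R/0]_(1 <= k <oo)
       ((-1) ^+ k *
        (2 ^+ k * (\prod_(0 <= i < k) (m%:R - 2 * i%:R)) /
         ((2 * k)`!)%:R) *
        conf_pow a x (2 * k))).

Definition hermite (R : realType) (m : nat) (u : R) : R :=
  (-1) ^+ m * expR (u ^+ 2) * derive1n m (fun v : R => expR (- v ^+ 2)) u.

Definition conf_integrand (R : realType) (a : R) (f : R -> R) (x : R) :
  \bar R := (f x * `|x| `^ (a - 1))%:E.

(* The integral over the whole line against x^(a-1) dx, as a Lebesgue
   integral; the value of the weight at x = 0 is irrelevant. *)
Definition conf_integrable (R : realType) (a : R) (f : R -> R) : Prop :=
  (@lebesgue_measure R).-integrable setT (conf_integrand a f).

Definition conf_integral (R : realType) (a : R) (f : R -> R) : \bar R :=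
  (\int[@lebesgue_measure R]_(x in setT) conf_integrand a f x)%E.

(* Main.v *)
Require Import Defs.
From HB Require Import structures.
From mathcomp Require Import all_boot all_order all_algebra.
From mathcomp Require Import all_classical all_reals all_analysis.
From mathcomp Require Import measurable_realfun ring lra.

Import Order.TTheory GRing.Theory Num.Theory.
Import numFieldNormedType.Exports.

Local Open Scope classical_set_scope.
Local Open Scope ring_scope.

(** Everything is transported from the classical Hermite polynomials by the
    substitution [u = x^a].

    The polynomials [hermite_poly n] are defined by
    [H_(n+1) = 2 X H_n - H_n'], so that [H_n' = 2 n H_(n-1)] and
    [H_n'' - 2 X H_n' + 2 n H_n = 0].  The differential equation gives each
    coefficient of [H_n] from the one two degrees below, which turns the
    explicit series of [conf_hermite] into [H_n] evaluated at the signed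
    power [u = conf_pow a x 1] ([conf_hermiteE]).  On the other side,
    [(p e^(-u^2))' = (p' - 2 X p) e^(-u^2)] identifies [hermite_poly n] with
    Rodrigues' formula ([hermiteE]).

    The quotient defining the conformable derivative of [f] at [x] is the
    growth rate of [f] at [x] in the direction [x^(1-a)].  Hence if
    [f x = g (x^a)], the chain rule gives [T_a f x = a g'(x^a)], and the
    [m]-th iterate is [a^m g^(m)(x^a)] ([conf_deriven_powR]).  The
    differential identities follow by taking for [g] a Hermite polynomial or
    the Gaussian.

    For the integrals, the substitution [u = x^a] for [x >= c > 0] and the limit
    [c -> 0] reduce the integral of [u^k e^(-u^2) |x|^(a-1)] over a half-line
    to [a^-1] times a Gaussian half-moment, the negative half-line contributing
    the sign [(-1)^k] ([integral_conf_kernel]).  By linearity the integral of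
    [p(u) e^(-u^2) |x|^(a-1)] is [a^-1 * gauss_mean p], where [gauss_mean] is a
    linear form on polynomials such that [gauss_mean p' = gauss_mean (2 X p)].
    Integrating by parts [n] times is then the purely algebraic identity
    [gauss_mean (p H_n) = gauss_mean p^(n)], and orthogonality and the norms are
    read off for [p = H_m] with [m <= n]. *)

Set Implicit Arguments.
Unset Strict Implicit.

(** * Hermite polynomials and their coefficients *)

Section hermite_polynomials.
Variable R : realType.
Implicit Types (p q : {poly R}) (m n k i : nat) (u x a : R).

(** The physicists' Hermite polynomials, as formal polynomials. *)
Fixpoint hermite_poly n : {poly R} :=
  if n is n'.+1 then
    2 *: 'X * hermite_poly n' - (hermite_poly n')^`()
  else 1.

Lemma hermite_polyS n :
  hermite_poly n.+1 = 2 *: 'X * hermite_poly n - (hermite_poly n)^`().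
Proof. by []. Qed.

Lemma deriv_hermite_poly n :
  (hermite_poly n.+1)^`() = (2 * n.+1%:R) *: hermite_poly n.
Proof.
elim: n => [|n IHn].
  by rewrite /= -polyC1 derivC subr0 mulr1 derivZ derivX mulr1 polyC1.
rewrite hermite_polyS derivB derivM derivZ derivX IHn derivZ.
rewrite [hermite_poly n.+1]hermite_polyS -!mul_polyC !rmorphM !rmorph_nat.
by ring.
Qed.

Lemma derivn_hermite_poly n :
  (hermite_poly n)^`(n) = (2 ^+ n * n`!%:R)%:P.
Proof.
elim: n => [|n IHn]; first by rewrite /= expr0 fact0 mul1r.
rewrite derivSn deriv_hermite_poly derivnZ IHn scale_polyC.
by rewrite exprS factS natrM; congr (_%:P); ring.
Qed.

Lemma hermite_poly_recl n :
  hermite_poly n.+2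
  = 2 *: 'X * hermite_poly n.+1 - (2 * n.+1%:R) *: hermite_poly n.
Proof. by rewrite hermite_polyS deriv_hermite_poly. Qed.

Lemma hermite_poly_ode n :
  (hermite_poly n)^`()^`() - 2 *: 'X * (hermite_poly n)^`()
  + (2 * n%:R) *: hermite_poly n = 0.
Proof.
case: n => [|n].
  by rewrite /= -polyC1 derivC deriv0 mulr0 mulr0 scale0r subr0 addr0.
rewrite deriv_hermite_poly derivZ [X in _ + _ *: X]hermite_polyS.
by rewrite -!mul_polyC !rmorphM !rmorph_nat; ring.
Qed.

(** The coefficient form of the differential equation. *)
Lemma coef_hermite_polySS n i :
  (hermite_poly n)`_i.+2
  = - 2 * (n%:R - i%:R) / (i.+1 * i.+2)%:R * (hermite_poly n)`_i.
Proof.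
have /(congr1 (fun p => p`_i)) := hermite_poly_ode n.
have coefXd : ('X * (hermite_poly n)^`())`_i = (hermite_poly n)`_i *+ i.
  by rewrite coefXM; case: i => [|i]; rewrite ?mulr0n //= coef_deriv.
rewrite coefD coefB coefZ -scalerAl coefZ coefXd !coef_deriv coef0.
move=> h.
have nz : (i.+1 * i.+2)%:R != 0 :> R by rewrite pnatr_eq0.
apply: (mulfI nz); rewrite mulrA [in RHS]mulrCA divff // mulr1.
move: h; rewrite -mulrnA -[_ *+ (_ * _)]mulr_natr -[_ *+ i]mulr_natr.
by rewrite mulnC => h; lra.
Qed.

Lemma size_hermite_poly n : (size (hermite_poly n) <= n.+1)%N.
Proof.
elim: n => [|n IHn]; first by rewrite size_poly1.
rewrite hermite_polyS (leq_trans (size_polyD _ _)) // size_polyN geq_max.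
apply/andP; split.
  rewrite -scalerAl (leq_trans (size_scale_leq _ _)) //.
  by rewrite (leq_trans (size_polyMleq _ _)) // size_polyX.
have [->|p0] := eqVneq (hermite_poly n) 0; first by rewrite deriv0 size_poly0.
by rewrite (leq_trans (ltnW (lt_size_deriv p0))) // (leq_trans IHn).
Qed.

Lemma coef0_hermite_polyS n :
  (hermite_poly n.+1)`_0 = - (hermite_poly n)`_1.
Proof.
by rewrite hermite_polyS coefB -scalerAl coefZ coefXM mulr0 sub0r coef_deriv.
Qed.

Lemma coef1_hermite_polyS n :
  (hermite_poly n.+1)`_1 = 2 * n.+1%:R * (hermite_poly n)`_0.
Proof. by rewrite -coefZ -deriv_hermite_poly coef_deriv. Qed.

Lemma coef0_hermite_poly_even k :
  (hermite_poly k.*2)`_0 = (-2) ^+ k * (dfact k.*2.-1)%:R.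
Proof.
elim: k => [|k IHk]; first by rewrite coef1 expr0 mul1r.
rewrite doubleS coef0_hermite_polyS coef1_hermite_polyS IHk.
rewrite exprS succnK.
have -> : dfact k.*2.+1 = (k.*2.+1 * dfact k.*2.-1)%N by case: k {IHk}.
by rewrite natrM; ring.
Qed.

Lemma coef1_hermite_poly_even k : (hermite_poly k.*2)`_1 = 0.
Proof.
elim: k => [|k IHk]; first by rewrite coef1.
by rewrite doubleS coef1_hermite_polyS coef0_hermite_polyS IHk oppr0 mulr0.
Qed.

Lemma coef0_hermite_poly_odd k : (hermite_poly k.*2.+1)`_0 = 0.
Proof. by rewrite coef0_hermite_polyS coef1_hermite_poly_even oppr0. Qed.

Lemma coef1_hermite_poly_odd k :
  (hermite_poly k.*2.+1)`_1 = - ((-2) ^+ k.+1 * (dfact k.*2.+1)%:R).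
Proof.
rewrite coef1_hermite_polyS coef0_hermite_poly_even.
have -> : dfact k.*2.+1 = (k.*2.+1 * dfact k.*2.-1)%N by case: k.
by rewrite exprS natrM; ring.
Qed.

(** Solving the recurrence from degree 0 and from degree 1; no parity assumption
    on [n] is needed, since the initial coefficient of the wrong parity is 0. *)
Lemma coef_hermite_poly_double n k :
  (hermite_poly n)`_(k.*2) = (hermite_poly n)`_0 *
    ((-1) ^+ k * (2 ^+ k * \prod_(0 <= i < k) (n%:R - 2 * i%:R) /
      ((2 * k)`!)%:R)).
Proof.
elim: k => [|k IHk].
  by rewrite big_geq // !expr0 muln0 fact0 divr1 !mulr1.
rewrite doubleS coef_hermite_polySS IHk big_nat_recr //= -mul2n.
rewrite [(2 * k.+1)%N]mulnS !add2n !factS mulnA !natrM !exprS.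
have nz : (2 * k)`!%:R != 0 :> R by rewrite pnatr_eq0 -lt0n fact_gt0.
by field; rewrite nz /= -?natrM ?nat1r ?natr1 -?natrD ?pnatr_eq0.
Qed.

Lemma coef_hermite_poly_doubleS n k :
  (hermite_poly n)`_(k.*2.+1) = (hermite_poly n)`_1 *
    ((-1) ^+ k * (2 ^+ k * \prod_(0 <= i < k) (n%:R - 1 - 2 * i%:R) /
      ((2 * k + 1)`!)%:R)).
Proof.
elim: k => [|k IHk].
  by rewrite big_geq // !expr0 muln0 -[(0 + 1)`!]/1%N divr1 !mulr1.
rewrite doubleS coef_hermite_polySS IHk big_nat_recr //= -mul2n.
rewrite [(2 * k.+1)%N]mulnS !add2n addSn addSn !factS mulnA !natrM !exprS addn1.
have nz : (2 * k).+1`!%:R != 0 :> R by rewrite pnatr_eq0 -lt0n fact_gt0.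
by field; rewrite nz /= -?natrM ?nat1r ?natr1 -?natrD ?pnatr_eq0.
Qed.

Lemma horner_double p u n : (size p <= n.*2)%N ->
  p.[u] = \sum_(0 <= k < n) p`_k.*2 * u ^+ k.*2
        + \sum_(0 <= k < n) p`_k.*2.+1 * u ^+ k.*2.+1.
Proof.
move=> pn; rewrite (horner_coef_wide _ pn).
rewrite -(big_mkord xpredT (fun i => p`_i * u ^+ i)).
elim: n {pn} => [|n IHn]; first by rewrite !big_geq // addr0.
by rewrite doubleS !big_nat_recr //= IHn; ring.
Qed.

(** The powers of the signed root [conf_pow a x 1], also for [x < 0]. *)
Lemma conf_powE a x k : conf_pow a x k = conf_pow a x 1 ^+ k.
Proof.
rewrite /conf_pow; case: ifPn => // x0.
by rewrite mul1r mulrC powRrM powR_mulrn // powR_ge0.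
Qed.

Lemma nat_series_finite (F : nat -> R) n : (0 < n)%N ->
  (forall k, (n <= k)%N -> F k = 0) ->
  \big[+%R/0]_(1 <= k <oo) F k = \sum_(1 <= k < n) F k.
Proof.
move=> n0 F0; apply: lim_near_cst => //.
exists n => // N /= nN.
rewrite (@big_cat_nat _ _ _ n) //= [X in _ + X]big_nat_cond.
by rewrite [X in _ + X]big1 ?addr0 // => k /andP[/andP[/F0 ->]].
Qed.

(** The explicit series is [H_n] at the signed power, for every real [x]. *)
Lemma conf_hermiteE a n x :
  conf_hermite a n x = (hermite_poly n).[conf_pow a x 1].
Proof.
set u := conf_pow a x 1.
have sz : (size (hermite_poly n) <= n.+1.*2)%N.
  by rewrite (leq_trans (size_hermite_poly n)) // -addnn leq_addr.
rewrite (horner_double _ sz) /conf_hermite.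
(* The factor of index n./2 kills every term of rank k > n; any cutoff beyond
   n./2 would do, and n.+1 also bounds the size of [hermite_poly n]. *)
have prod0 (c : R) k : c = (n./2.*2)%:R -> (n.+1 <= k)%N ->
    \prod_(0 <= i < k) (c - 2 * i%:R) = 0.
  move=> -> nk; rewrite (bigD1_seq n./2) ?iota_uniq ?mem_index_iota //=.
    by rewrite -mul2n natrM subrr mul0r.
  by rewrite (leq_trans _ nk) // ltnS -divn2 leq_div.
have nE : n = (odd n + n./2.*2)%N by rewrite odd_double_half.
case: ifPn => [on|/negbTE en]; rewrite ?on ?en ?add1n ?add0n in nE.
  have nh : n.+1./2 = n./2.+1 by rewrite {1}nE -doubleS doubleK.
  rewrite [X in _ = X + _]big1 => [|k _]; last first.
    by rewrite coef_hermite_poly_double nE coef0_hermite_poly_odd !mul0r.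
  under [in RHS]eq_bigr do rewrite coef_hermite_poly_doubleS -mulrA.
  rewrite -mulr_sumr add0r {4}nE coef1_hermite_poly_odd nh -nE mulNr.
  congr (- (_ * _)); rewrite big_ltn // [\prod_(0 <= i < 0) _]big_geq //.
  rewrite double0 muln0 -[(0 + 1)`!]/1%N !expr0 divr1 !mul1r; congr (_ + _).
  rewrite (@nat_series_finite _ n.+1) // => [|k nk].
    by apply: eq_bigr => k _; rewrite conf_powE -/u addn1 mul2n.
  by rewrite prod0 // ?(mulr0, mul0r) // {1}nE -natr1 addrK.
rewrite [X in _ = _ + X]big1 => [|k _]; last first.
  by rewrite coef_hermite_poly_doubleS nE coef1_hermite_poly_even !mul0r.
under [in RHS]eq_bigr do rewrite coef_hermite_poly_double -mulrA.
rewrite -mulr_sumr addr0 {4}nE coef0_hermite_poly_even -nE.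
congr (_ * _); rewrite big_ltn // [\prod_(0 <= i < 0) _]big_geq //.
rewrite double0 muln0 fact0 !expr0 divr1 !mul1r; congr (_ + _).
rewrite (@nat_series_finite _ n.+1) // => [|k nk].
  by apply: eq_bigr => k _; rewrite conf_powE -/u mul2n.
by rewrite prod0 // ?(mulr0, mul0r) // {1}nE.
Qed.

End hermite_polynomials.

(** * Conformable derivatives of functions of x^a *)

Section conformable_derivative.
Variables (R : realType) (a : R).
Implicit Types (f g : R -> R) (m k : nat) (x u d : R).

(** The conformable quotient is a growth rate in the direction [x^(1-a)]. *)
Lemma conf_quotE f x :
  conf_quot a f x =
  (fun e => e^-1 *: ((f \o shift x) (e *: x `^ (1 - a)) - f x)).
Proof.
by apply/funext => e; rewrite /conf_quot /= mulrC [x + _]addrC.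
Qed.

Lemma is_derive_dir f x d v : is_derive x 1 f d -> is_derive x v f (v * d).
Proof.
move=> [df <-]; have Df : differentiable f x by exact/derivable1_diffP.
apply: DeriveDef; first exact: diff_derivable.
by rewrite !deriveE // -[in LHS](mulr1 v) -[v * 1]/(v *: 1) linearZ.
Qed.

(** Chain rule: [T_a (g (x^a)) = a g'(x^a)], as [x^(1-a) (x^a)' = a].  The
    function [f] needs to agree with [g (x^a)] on the open half-line only. *)
Lemma is_conf_derive_powR f g x d : 0 < x ->
  (forall y : R, 0 < y -> f y = g (y `^ a)) -> is_derive (x `^ a) 1 g d ->
  conf_derivable a f x /\ conf_derive a f x = a * d.
Proof.
move=> x0 fg dg.
have dgx : is_derive x 1 (g \o (@powR R)^~ a) (a * x `^ (a - 1) * d).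
  rewrite mulrC.
  exact: (@is_derive1_comp _ g ((@powR R)^~ a) _ _ _ dg (is_derive1_powR a x0)).
have near_fg : \forall y \near x, (g \o (@powR R)^~ a) y = f y.
  by near=> y; rewrite fg //; near: y; exact: lt_nbhsr.
have : is_derive x (x `^ (1 - a)) f (x `^ (1 - a) * (a * x `^ (a - 1) * d)).
  apply: is_derive_dir; exact: (near_eq_is_derive near_fg).
move=> [df Df]; rewrite /conf_derivable /conf_derive conf_quotE.
split; first exact: df.
have -> : a * d = x `^ (1 - a) * (a * x `^ (a - 1) * d).
  have -> : x `^ (a - 1) = (x `^ (1 - a))^-1 by rewrite -powRN opprB.
  by field; rewrite gt_eqF // powR_gt0.
exact: Df.
Unshelve. all: by end_near. Qed.

Lemma conf_deriven_powR f g m :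
  (forall y : R, 0 < y -> f y = g (y `^ a)) ->
  (forall k (u : R), derivable (derive1n k g) u 1) ->
  conf_nderivable a m f /\
  forall x : R, 0 < x -> conf_deriven a m f x = a ^+ m * derive1n m g (x `^ a).
Proof.
move=> fg dg.
have isd k u : is_derive u 1 (fun v => a ^+ k * derive1n k g v)
    (a ^+ k * derive1n k.+1 g u).
  apply: is_deriveZ; rewrite derive1nS derive1E.
  exact/derivableP.
have fE k x : 0 < x -> conf_deriven a k f x = a ^+ k * derive1n k g (x `^ a).
  elim: k x => [|k IHk] x x0; first by rewrite expr0 mul1r; exact: fg.
  rewrite [LHS]/= -/(conf_deriven a k f).
  have [_ ->] := is_conf_derive_powR x0 IHk (isd k _).
  by rewrite exprS mulrA.
split=> [k _ x x0|x x0]; last exact: fE.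
by have [] := is_conf_derive_powR x0 (fE k) (isd k _).
Qed.

End conformable_derivative.

(** * Rodrigues' formula *)

Section rodrigues.
Variable R : realType.
Implicit Types (p : {poly R}) (n : nat) (u : R).

Lemma derive1n_horner p n : derive1n n (horner p) = horner p^`(n).
Proof. by elim: n => [//|n IHn]; rewrite derive1nS IHn derivnS derivE. Qed.

Lemma is_derive_poly_gauss p u :
  is_derive u 1 (fun v : R => p.[v] * gauss_fun v)
    ((p^`() - 2 *: 'X * p).[u] * gauss_fun u).
Proof.
have dsq : is_derive u 1 (fun v : R => - v ^+ 2) (- (2 * u)).
  by apply: is_derive_eq; rewrite [u%:A]mulr1 -mulr2n mulr_natl.
have dg : is_derive u 1 (@gauss_fun R) (gauss_fun u * - (2 * u)).
  exact: (@is_derive1_comp _ expR (fun v : R => - v ^+ 2)).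
apply: (is_derive_eq (is_deriveM (is_derive_poly p u) dg)).
by rewrite !hornerE -![_ *: _]/(_ * _); ring.
Qed.

Lemma is_derive_hermite_gauss n u :
  is_derive u 1 (fun v : R => (hermite_poly R n).[v] * gauss_fun v)
    (- ((hermite_poly R n.+1).[u] * gauss_fun u)).
Proof.
apply: (is_derive_eq (is_derive_poly_gauss (hermite_poly R n) u)).
by rewrite hermite_polyS -opprB hornerN mulNr.
Qed.

Lemma derive1n_gauss n u :
  derive1n n (@gauss_fun R) u
  = (-1) ^+ n * ((hermite_poly R n).[u] * gauss_fun u).
Proof.
elim: n u => [|n IHn] u; first by rewrite expr0 mul1r hornerC mul1r.
rewrite derive1nS (_ : derive1n n _ =
  (fun v => (-1) ^+ n * ((hermite_poly R n).[v] * gauss_fun v))); last first.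
  exact/funext.
have := is_derive_hermite_gauss n u.
move=> /(is_deriveZ ((-1) ^+ n)) [_].
rewrite derive1E => ->.
by rewrite exprS scalerN mulN1r mulNr.
Qed.

Lemma hermiteE n u : hermite n u = (hermite_poly R n).[u].
Proof.
rewrite /hermite -/(@gauss_fun R) derive1n_gauss /gauss_fun.
rewrite mulrACA -exprD addnn -mul2n exprM sqrrN expr1n expr1n mul1r.
by rewrite mulrCA -expRD addrN expR0 mulr1.
Qed.

Lemma derivable_derive1n_gauss n u : derivable (derive1n n (@gauss_fun R)) u 1.
Proof.
rewrite (_ : derive1n n _ =
  (-1) ^+ n \*: (fun v => (hermite_poly R n).[v] * gauss_fun v)); last first.
  by apply/funext => v; rewrite derive1n_gauss.
by apply: derivableZ; have [] := is_derive_hermite_gauss n u.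
Qed.

End rodrigues.

(** * Gaussian moments on the half-line *)

Section gaussian_moments.
Variable R : realType.
Implicit Types (p : {poly R}) (k n : nat) (x u c : R).
Notation mu := (@lebesgue_measure R).

(** The function [u^k e^(-u^2)]. *)
Definition monomial_gauss k u : R := u ^+ k * gauss_fun u.

Lemma continuous_monomial_gauss k : continuous (monomial_gauss k).
Proof.
by move=> u; apply: cvgM; [exact: exprn_continuous|exact: continuous_gauss_fun].
Qed.

Lemma monomial_gauss_ge0 k u : 0 <= u -> 0 <= monomial_gauss k u.
Proof. by move=> u0; rewrite mulr_ge0 ?exprn_ge0 ?gauss_fun_ge0. Qed.

Lemma is_derive_monomial_gauss k u :
  is_derive u 1 (monomial_gauss k)
    (k%:R * monomial_gauss k.-1 u - 2 * monomial_gauss k.+1 u).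
Proof.
have -> : monomial_gauss k = (fun v => 'X^k.[v] * gauss_fun v).
  by apply/funext => v; rewrite hornerXn.
apply: (is_derive_eq (is_derive_poly_gauss 'X^k u)).
rewrite /monomial_gauss exprS derivXn hornerD hornerN hornerM hornerZ hornerX.
rewrite hornerMn !hornerXn -mulr_natl.
by ring.
Qed.

Lemma monomial_gauss_cvg0 k :
  monomial_gauss k n.+1%:R @[n --> \oo] --> (0 : R).
Proof.
apply: (@squeeze_cvgr _ _ _ _ (cst 0) (fun n => (k.+1)`!%:R * n.+1%:R^-1)).
- near=> n; rewrite monomial_gauss_ge0 //=.
  have n1 : 1 <= n.+1%:R :> R by rewrite ler1n.
  have n0 : 0 < n.+1%:R :> R by exact: lt_le_trans n1.
  have f0 : 0 < (k.+1)`!%:R :> R by rewrite ltr0n fact_gt0.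
  (* e^(n^2) >= e^n >= n^(k+1) / (k+1)! for n >= 1 *)
  rewrite /monomial_gauss /gauss_fun expRN ler_pdivrMr ?expR_gt0 //.
  rewrite -ler_pdivrMl ?divr_gt0 //.
  apply: (@le_trans _ _ (expR n.+1%:R)); last first.
    by rewrite ler_expR expr2 ler_peMl // ltW.
  apply: le_trans (expR_ge1Dxn k (ltW n0)); rewrite -[leLHS]add0r.
  apply: lerD => //; rewrite exprS le_eqVlt; apply/orP; left.
  by apply/eqP; field; rewrite !gt_eqF.
- exact: cvg_cst.
- rewrite -[X in _ --> X](mulr0 ((k.+1)`!%:R : R)).
  by apply: cvgM; [exact: cvg_cst|exact: cvg_harmonic].
Unshelve. all: by end_near. Qed.

(** The value of the integral of [u^k e^(-u^2)] over the positive half-line. *)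
Fixpoint half_moment k : R :=
  match k with
  | 0 => Num.sqrt pi / 2
  | 1 => 1 / 2
  | (k'.+1 as k1).+1 => k1%:R / 2 * half_moment k'
  end.

Lemma integrable_monomial_gauss_itv k c :
  mu.-integrable `[0%R, c] (EFin \o monomial_gauss k).
Proof.
apply: continuous_compact_integrable; first exact: segment_compact.
exact/continuous_subspaceT/continuous_monomial_gauss.
Qed.

(** The integral of [u^k e^(-u^2)] from 0 to [n + 1]; the truncation keeps
    the integrals finite while integrating by parts. *)
Definition truncated_moment k n : R :=
  (\int[mu]_(u in `[0%R, n.+1%:R]) monomial_gauss k u)%R.

(** Integration of [(u^k e^(-u^2))' = (k u^(k-1) - 2 u^(k+1)) e^(-u^2)].  For
    [k = 0] the predecessor is a dummy with coefficient 0, and the boundary term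
    at 0 contributes 1. *)
Lemma truncated_momentS k n :
  truncated_moment k.+1 n =
  (k%:R * truncated_moment k.-1 n + (k == 0)%:R - monomial_gauss k n.+1%:R) / 2.
Proof.
have n0 : 0 < n.+1%:R :> R by rewrite ltr0n.
have dF x : derivable (monomial_gauss k) x 1.
  by have [] := is_derive_monomial_gauss k x.
have cF : continuous (monomial_gauss k) := @continuous_monomial_gauss k.
have ftc : (\int[mu]_(x in `[0%R, n.+1%:R])
    (k%:R * monomial_gauss k.-1 x - 2 * monomial_gauss k.+1 x)%:E
    = (monomial_gauss k n.+1%:R)%:E - (monomial_gauss k 0)%:E)%E.
  apply: continuous_FTC2 => //.
  - apply: continuous_subspaceT => x.
    apply: cvgB; (apply: cvgM; first exact: cvg_cst);
      exact: continuous_monomial_gauss.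
  - split=> // [|].
      by apply: cvg_at_right_filter; exact: cF.
    by apply: cvg_at_left_filter; exact: cF.
  - by move=> x _; rewrite derive1E; have [] := is_derive_monomial_gauss k x.
have iZ (d : R) j : mu.-integrable `[0%R, n.+1%:R]
    (EFin \o (fun x => d * monomial_gauss j x)).
  by apply: (integrableZl _ d (integrable_monomial_gauss_itv j _)).
move: ftc => /(congr1 fine); rewrite -/(Rintegral _ _ _) RintegralB //.
rewrite !RintegralZl //; [|exact: integrable_monomial_gauss_itv..].
rewrite -!/(truncated_moment _ _) /= => h.
have m0 : monomial_gauss k 0 = (k == 0)%:R.
  by rewrite /monomial_gauss expr0n /gauss_fun expr0n /= oppr0 expR0 mulr1.
by rewrite m0 in h; lra.
Qed.

Lemma truncated_moment_integral k :
  (truncated_moment k n)%:E @[n --> \oo] -->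
  (\int[mu]_(u in `[0%R, +oo[) (monomial_gauss k u)%:E)%E.
Proof.
(* [ge0_cvgn_integral] wants an integrand nonnegative on the whole line *)
have normE (A : interval R) : [set` A] `<=` [set` `[0%R, +oo[] ->
    (\int[mu]_(u in [set` A]) (`|monomial_gauss k u|)%:E
     = \int[mu]_(u in [set` A]) (monomial_gauss k u)%:E)%E.
  move=> A0; apply: eq_integral => u; rewrite inE => /A0 /=.
  by rewrite in_itv /= andbT => u0; rewrite ger0_norm // monomial_gauss_ge0.
have mk : measurable_fun setT (fun u => `|monomial_gauss k u|).
  apply: measurableT_comp => //.
  apply: continuous_measurable_fun; exact: continuous_monomial_gauss.
have := @ge0_cvgn_integral R mu _ (fun=> normr_ge0 _) mk.
rewrite normE // -cvg_shiftS; apply: cvg_trans.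
apply: near_eq_cvg; apply: nearW => n /=.
rewrite normE => [|u /=]; last by rewrite !in_itv /= andbT => /andP[].
rewrite fineK //; apply: integrable_fin_num => //.
exact: integrable_monomial_gauss_itv.
Qed.

Lemma truncated_moment_cvg k :
  truncated_moment k n @[n --> \oo] --> half_moment k.
Proof.
have step j (l : R) : (j%:R * truncated_moment j.-1 n @[n --> \oo] --> l) ->
    truncated_moment j.+1 n @[n --> \oo] --> (l + (j == 0)%:R) / 2.
  move=> jl; under eq_cvg do rewrite truncated_momentS.
  apply: cvgM; last exact: cvg_cst.
  rewrite -[X in _ --> X]subr0; apply: cvgB; last exact: monomial_gauss_cvg0.
  by apply: cvgD => //; exact: cvg_cst.
have [] : (truncated_moment k n @[n --> \oo] --> half_moment k) /\
    (truncated_moment k.+1 n @[n --> \oo] --> half_moment k.+1); last by [].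
elim: k => [|k [IH0 IH1]].
  have t0 : truncated_moment 0 n @[n --> \oo] --> half_moment 0.
    have := @truncated_moment_integral 0.
    under eq_integral do rewrite /monomial_gauss expr0 mul1r.
    by rewrite integral0y_gauss => /fine_cvgP[].
  split=> //; have := step 0 0; rewrite add0r; apply.
  by under eq_cvg do rewrite mul0r; exact: cvg_cst.
split=> //; have := step k.+1 (k.+1%:R * half_moment k).
rewrite addr0 /= mulrAC; apply.
by apply: cvgM => //; exact: cvg_cst.
Qed.

Lemma integral_monomial_gauss k :
  (\int[mu]_(u in `[0%R, +oo[) (monomial_gauss k u)%:E)%E = (half_moment k)%:E.
Proof.
apply: (cvg_unique _ (@truncated_moment_integral k)) => //.
by apply: cvg_EFin; [exact: nearW|exact: truncated_moment_cvg].
Qed.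

End gaussian_moments.

(** * The substitution u = x^a in integrals *)

Section power_substitution.
Variables (R : realType) (a : R).
Hypotheses (a0 : 0 < a) (a1 : a <= 1).
Implicit Types (k n : nat) (x u c : R).
Notation mu := (@lebesgue_measure R).

Lemma powR_cvgy (r : R) : 0 < r -> (x : R) `^ r @[x --> +oo%R] --> +oo%R.
Proof.
move=> r0; apply/cvgryPge => A; near=> x.
have x0 : 0 <= x by near: x; apply: nbhs_pinfty_ge; exact: num_real.
have Ax : `|A| `^ r^-1 <= x.
  by near: x; apply: nbhs_pinfty_ge; exact: num_real.
rewrite (le_trans (ler_norm A)) // -(powRr1 (normr_ge0 A)).
rewrite -(mulVf (lt0r_neq0 r0)) powRrM.
by apply: ge0_ler_powR => //; rewrite ?nnegrE ?powR_ge0 // ltW.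
Unshelve. all: by end_near. Qed.

Lemma powRB1_cvgy : cvg ((x : R) `^ (a - 1) @[x --> +oo%R]).
Proof.
move: a1; rewrite le_eqVlt => /predU1P[->|lta1].
  apply/cvg_ex; exists 1; rewrite subrr.
  by under eq_cvg do rewrite powRr0; exact: cvg_cst.
apply/cvg_ex; exists 0.
have -> : (fun x => x `^ (a - 1)) = (fun x => (x `^ (1 - a))^-1).
  by apply/funext => x; rewrite -powRN opprB.
apply/gtr0_cvgV0; last by apply: powR_cvgy; rewrite subr_gt0.
by near=> x; rewrite powR_gt0.
Unshelve. all: by end_near. Qed.

Lemma continuous_powR (r : R) x :
  0 < x -> {for x, continuous (fun y : R => y `^ r)}.
Proof.
move=> x0; apply/differentiable_continuous/derivable1_diffP.
by have [] := is_derive1_powR r x0.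
Qed.

Lemma continuous_derive1_powR x : 0 < x ->
  {for x, continuous (fun y : R => y `^ a)^`()%classic}.
Proof.
move=> x0.
have near_d : \forall y \near x,
    a * y `^ (a - 1) = (fun y : R => y `^ a)^`()%classic y.
  near=> y; rewrite powR_derive1 // in_itv /= andbT.
  by near: y; exact: lt_nbhsr.
apply: cvg_trans (near_eq_cvg near_d) _.
rewrite powR_derive1 ?in_itv /= ?andbT //.
by apply: cvgM; [exact: cvg_cst|exact: continuous_powR].
Unshelve. all: by end_near. Qed.

(** The lower bound [c] is positive because the derivative of [x^a] blows up at
    0 when [a < 1]. *)
Lemma integral_powR_substitution (G : R -> R) c : 0 < c ->
  continuous G -> (forall u, 0 <= u -> 0 <= G u) ->
  (\int[mu]_(u in `[(c `^ a)%R, +oo[) (G u)%:E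
   = \int[mu]_(x in `[c, +oo[) (G (x `^ a) * (a * x `^ (a - 1)))%:E)%E.
Proof.
move=> c0 cG G0.
rewrite (@increasing_ge0_integration_by_substitutiony R (fun y => y `^ a) G c).
- apply: eq_integral => x; rewrite inE /= in_itv /= andbT => cx.
  transitivity (G (x `^ a) * (fun y : R => y `^ a)^`()%classic x)%:E => //.
  by rewrite powR_derive1 // in_itv /= andbT (lt_le_trans c0).
- move=> x y; rewrite !in_itv /= !andbT => cx cy xy.
  by apply: gt0_ltr_powR => //; rewrite nnegrE ltW // (lt_le_trans c0).
- move=> x; rewrite in_itv /= andbT => cx.
  by apply: continuous_derive1_powR; exact: lt_trans cx.
- apply/cvg_ex; exists ((fun y : R => y `^ a)^`()%classic c).
  by apply: cvg_at_right_filter; exact: continuous_derive1_powR.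
- have /cvg_ex[l cl] := powRB1_cvgy; apply/cvg_ex; exists (a * l).
  apply: cvg_trans (cvgM (cvg_cst a) cl); apply: near_eq_cvg; near=> x.
  rewrite powR_derive1 // in_itv /= andbT.
  by near: x; apply: nbhs_pinfty_gt; exact: num_real.
- split=> [x|].
    rewrite in_itv /= andbT => cx.
    by have [] := is_derive1_powR a (lt_trans c0 cx).
  by apply: cvg_at_right_filter; exact: continuous_powR.
- exact: powR_cvgy.
- exact: continuous_subspaceT.
- move=> u; rewrite in_itv /= andbT => cu.
  by apply: G0; rewrite (le_trans (powR_ge0 _ _) (ltW cu)).
Unshelve. all: by end_near. Qed.

(** The function [u^k e^(-u^2) |x|^(a-1)] with [u = |x|^a]. *)
Definition even_kernel k x : R :=
  monomial_gauss k (`|x| `^ a) * `|x| `^ (a - 1).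

Lemma even_kernel_ge0 k x : 0 <= even_kernel k x.
Proof. by rewrite mulr_ge0 ?monomial_gauss_ge0 ?powR_ge0. Qed.

Lemma measurable_even_kernel k : measurable_fun setT (even_kernel k).
Proof.
have mpow r : measurable_fun setT (fun x : R => `|x| `^ r).
  exact: (@measurableT_comp _ _ _ _ _ _ (fun y : R => y `^ r)).
apply: measurable_funM; last exact: mpow.
apply: measurableT_comp (mpow a).
by apply: continuous_measurable_fun; exact: continuous_monomial_gauss.
Qed.

(** Integrals from [b n > 0] to infinity exhaust the one over
    the open half-line. *)
Lemma cvg_integral_oy (b : nat -> R) (f : R -> \bar R) :
  (forall n, 0 < b n) -> (forall n, b n.+1 <= b n) ->
  b n @[n --> \oo] --> 0 ->
  measurable_fun (`]0%R, +oo[ : set R) f -> (forall x, 0 < x -> (0 <= f x)%E) ->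
  (\int[mu]_(x in `[(b n)%R, +oo[) f x)%E @[n --> \oo] -->
  (\int[mu]_(x in `]0%R, +oo[) f x)%E.
Proof.
move=> b0 bdec bcvg mf f0.
have sub n : `[b n, +oo[ `<=` `]0%R, +oo[.
  by move=> x /=; rewrite !in_itv /= !andbT => /(lt_le_trans (b0 n)).
have -> : `]0%R, +oo[%classic = \bigcup_n `[b n, +oo[%classic.
  apply/seteqP; split=> [x /=|x [n _]]; last exact: sub.
  rewrite in_itv /= andbT => x0.
  have [N _ /(_ N (leqnn N)) /= bN] := cvgr_lt 0 bcvg x x0.
  by exists N => //=; rewrite in_itv /= andbT ltW.
apply: ge0_nondecreasing_set_cvg_integral.
- apply/nondecreasing_seqP => n; rewrite subsetEset => x /=.
  by rewrite !in_itv /= !andbT; apply: le_trans.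
- by [].
- by move=> n; apply: measurable_funS mf => //; exact: sub.
- by move=> n x /sub /=; rewrite in_itv /= andbT; exact: f0.
Qed.

(** Both sides of the substitution formula with lower bound [c = 1 / (n + 1)]
    converge to the integrals over the open half-line. *)
Lemma integral_even_kernel_oy k :
  (\int[mu]_(x in `]0%R, +oo[) (even_kernel k x)%:E
   = (a^-1 * half_moment R k)%:E)%E.
Proof.
pose b n : R := n.+1%:R^-1.
have b0 n : 0 < b n by rewrite invr_gt0.
have bS n : b n.+1 <= b n by rewrite lef_pV2 ?posrE // ler_nat.
have bcvg : b n @[n --> \oo] --> 0 := cvg_harmonic.
pose B n := b n `^ a.
have B0 n : 0 < B n by exact: powR_gt0.
have BS n : B n.+1 <= B n by apply: ge0_ler_powR => //; rewrite ?nnegrE ltW.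
have Bcvg : B n @[n --> \oo] --> 0.
  apply/cvgrPdist_lt => e e0; near=> n.
  rewrite sub0r normrN ger0_norm ?(ltW (B0 _)) //.
  rewrite -(powRr1 (ltW e0)) -[X in e `^ X](mulVf (lt0r_neq0 a0)) powRrM.
  apply: gt0_ltr_powR; rewrite ?nnegrE ?powR_ge0 ?(ltW (b0 _)) //.
  near: n; apply: (cvgr_lt 0 bcvg); exact: powR_gt0.
have mm : measurable_fun setT (EFin \o @monomial_gauss R k).
  apply/measurable_EFinP; apply: continuous_measurable_fun.
  exact: continuous_monomial_gauss.
have mw : measurable_fun setT (EFin \o even_kernel k).
  by apply/measurable_EFinP; exact: measurable_even_kernel.
have w0 x : 0 < x -> (0 <= (EFin \o even_kernel k) x)%E.
  by rewrite lee_fin even_kernel_ge0.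
have m0 x : 0 < x -> (0 <= (EFin \o @monomial_gauss R k) x)%E.
  by move=> x0; rewrite lee_fin monomial_gauss_ge0 // ltW.
have cvg_w := cvg_integral_oy b0 bS bcvg (measurable_funTS mw) w0.
have cvg_m := cvg_integral_oy B0 BS Bcvg (measurable_funTS mm) m0.
have : (\int[mu]_(u in `[(B n)%R, +oo[) (monomial_gauss k u)%:E)%E @[n --> \oo]
    --> (a%:E * \int[mu]_(x in `]0%R, +oo[) (even_kernel k x)%:E)%E.
  apply: cvg_trans (cvgeZl _ cvg_w) => //.
  apply: near_eq_cvg; apply: nearW => n /=.
  rewrite integral_powR_substitution //; last first.
  - exact: monomial_gauss_ge0.
  - exact: continuous_monomial_gauss.
  rewrite -ge0_integralZl //.
  - apply: eq_integral => x; rewrite inE /= in_itv /= andbT => bx.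
    by rewrite /even_kernel ger0_norm ?(le_trans (ltW (b0 n))) // -EFinM mulrCA.
  - exact: measurable_funTS.
  - by move=> x _; rewrite lee_fin even_kernel_ge0.
  - by rewrite lee_fin ltW.
move=> /(cvg_unique _ cvg_m) h.
have {h} := h (@ereal_hausdorff R).
rewrite /= integral_itv_obnd_cbnd ?integral_monomial_gauss; last first.
  exact: measurable_funTS.
by move=> h; rewrite EFinM h muleA -EFinM mulVf ?gt_eqF // mul1e.
Unshelve. all: by end_near. Qed.

Lemma integral_even_kernel k :
  (\int[mu]_(x in `[0%R, +oo[) (even_kernel k x)%:E
   = (a^-1 * half_moment R k)%:E)%E
  /\
  (\int[mu]_(x in `]-oo, 0%R[) (even_kernel k x)%:E
   = (a^-1 * half_moment R k)%:E)%E.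
Proof.
have mw : measurable_fun setT (EFin \o even_kernel k).
  by apply/measurable_EFinP; exact: measurable_even_kernel.
have ipos : (\int[mu]_(x in `[0%R, +oo[) (even_kernel k x)%:E
    = (a^-1 * half_moment R k)%:E)%E.
  rewrite -integral_itv_obnd_cbnd ?integral_even_kernel_oy //.
  exact: measurable_funTS.
split=> //; rewrite -ipos integral_itv_bndo_bndc; last exact: measurable_funTS.
rewrite (ge0_integration_by_substitution0 mw); last first.
  by move=> x; rewrite lee_fin even_kernel_ge0.
by apply: eq_integral => x _; rewrite /= /even_kernel normrN.
Qed.

(** The function [u^k e^(-u^2) |x|^(a-1)] with [u] the signed power of [x]; it
    has the parity of [k]. *)
Definition conf_kernel k x : R :=
  monomial_gauss k (conf_pow a x 1) * `|x| `^ (a - 1).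

Lemma conf_kernelE k x :
  conf_kernel k x = (if 0 <= x then 1 else (-1) ^+ k) * even_kernel k x.
Proof.
rewrite /conf_kernel /conf_pow /even_kernel; case: ifPn => x0.
  by rewrite !mul1r ger0_norm.
rewrite expr1 /monomial_gauss [(- (_ `^ _)) ^+ k]exprNn.
by rewrite /gauss_fun sqrrN !mulrA.
Qed.

Lemma setT_split0 : [set: R] = `]-oo, 0%R[ `|` `[0%R, +oo[.
Proof.
apply/seteqP; split=> // x _ /=; rewrite !in_itv /= andbT.
by case: (ltP x 0) => _; [left|right].
Qed.

Lemma disjoint_split0 : [disjoint (`]-oo, 0%R[ : set R) & `[0%R, +oo[].
Proof.
rewrite disj_set2E; apply/eqP; rewrite -subset0 => x [] /=.
by rewrite !in_itv /= andbT ltNge => /negP.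
Qed.

Lemma integrable_even_kernel k : mu.-integrable setT (EFin \o even_kernel k).
Proof.
have mw : measurable_fun setT (EFin \o even_kernel k).
  by apply/measurable_EFinP; exact: measurable_even_kernel.
apply/integrableP; split=> //.
under eq_integral do rewrite gee0_abs ?lee_fin ?even_kernel_ge0 //.
have [ipos ineg] := integral_even_kernel k.
rewrite setT_split0 integral_setU //;
  [|by rewrite -setT_split0|exact: disjoint_split0].
by rewrite /= ipos ineg -EFinD ltry.
Qed.

Lemma measurable_conf_kernel k : measurable_fun setT (conf_kernel k).
Proof.
have -> : conf_kernel k =
    (fun x => (if 0 <= x then 1 else (-1) ^+ k) * even_kernel k x).
  by apply/funext => x; exact: conf_kernelE.
apply: measurable_funM; last exact: measurable_even_kernel.
by apply: measurable_fun_ifT => //; exact: measurable_fun_ler.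
Qed.

Lemma integrable_conf_kernel k : mu.-integrable setT (EFin \o conf_kernel k).
Proof.
apply: le_integrable (integrable_even_kernel k) => //.
  by apply/measurable_EFinP; exact: measurable_conf_kernel.
move=> x _; rewrite /= lee_fin conf_kernelE normrM.
by case: ifPn => _; rewrite ?normrX ?normrN normr1 ?expr1n mul1r.
Qed.

Lemma integral_conf_kernel k :
  (\int[mu]_x (conf_kernel k x)%:E
   = (a^-1 * ((1 + (-1) ^+ k) * half_moment R k))%:E)%E.
Proof.
have [ipos ineg] := integral_even_kernel k.
have mk : measurable_fun setT (EFin \o conf_kernel k).
  by apply/measurable_EFinP; exact: measurable_conf_kernel.
rewrite setT_split0 integral_setU //;
  [|by rewrite -setT_split0|exact: disjoint_split0].
have -> : (\int[mu]_(x in `[0%R, +oo[) (conf_kernel k x)%:E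
    = \int[mu]_(x in `[0%R, +oo[) (even_kernel k x)%:E)%E.
  apply: eq_integral => x; rewrite inE /= in_itv /= andbT => x0.
  by rewrite conf_kernelE x0 mul1r.
have -> : (\int[mu]_(x in `]-oo, 0%R[) (conf_kernel k x)%:E
    = ((-1) ^+ k)%:E * \int[mu]_(x in `]-oo, 0%R[) (even_kernel k x)%:E)%E.
  rewrite -integralZl //; last exact: integrableS (integrable_even_kernel k).
  apply: eq_integral => x; rewrite inE /= in_itv /= => x0.
  by rewrite conf_kernelE leNgt x0.
by rewrite ipos ineg -EFinM -EFinD; congr (_%:E); ring.
Qed.

End power_substitution.

(** * Orthogonality *)

Section orthogonality.
Variable R : realType.
Implicit Types (p q : {poly R}) (m n k : nat) (a x : R).
Notation mu := (@lebesgue_measure R).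

(** The integral of [u^k e^(-u^2)] over the whole line. *)
Definition full_moment k : R := (1 + (-1) ^+ k) * half_moment R k.

Lemma full_moment0 : full_moment 0 = Num.sqrt pi.
Proof. by rewrite /full_moment /= expr0; field. Qed.

(** For [k = 0] the right-hand side is 0 whatever the dummy predecessor. *)
Lemma full_momentS k : 2 * full_moment k.+1 = k%:R * full_moment k.-1.
Proof.
case: k => [|k]; first by rewrite /full_moment expr1 subrr !mul0r mulr0.
by rewrite /full_moment /= !exprS; field.
Qed.

(** The integral of [p e^(-u^2)] over the whole line, as a linear form on
    polynomials given by its values on monomials. *)
Definition gauss_mean p : R := \sum_(i < size p) p`_i * full_moment i.

Lemma gauss_mean_wide n p : (size p <= n)%N ->
  gauss_mean p = \sum_(0 <= i < n) p`_i * full_moment i.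
Proof.
move=> pn; rewrite (@big_cat_nat _ _ _ (size p)) //=.
rewrite [X in _ = _ + X]big_nat_cond.
rewrite [X in _ = _ + X]big1 ?addr0 => [|i /andP[/andP[pi _] _]].
  by rewrite big_mkord.
by rewrite nth_default ?mul0r.
Qed.

Lemma gauss_meanB p q : gauss_mean (p - q) = gauss_mean p - gauss_mean q.
Proof.
pose n := maxn (size p) (size q).
rewrite !(@gauss_mean_wide n) ?leq_maxl ?leq_maxr //; last first.
  by rewrite (leq_trans (size_polyD _ _)) // size_polyN.
by rewrite -sumrB; apply: eq_bigr => i _; rewrite coefB mulrBl.
Qed.

(** The integral of [(p e^(-u^2))'] vanishes. *)
Lemma gauss_mean_deriv p : gauss_mean p^`() = gauss_mean (2 *: 'X * p).
Proof.
rewrite (@gauss_mean_wide (size p)); last first.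
  have [->|p0] := eqVneq p 0; first by rewrite deriv0.
  exact/ltnW/lt_size_deriv.
rewrite (@gauss_mean_wide (size p).+1); last first.
  rewrite -scalerAl (leq_trans (size_scale_leq _ _)) //.
  by rewrite (leq_trans (size_polyMleq _ _)) // size_polyX.
rewrite [RHS]big_nat_recl // -scalerAl coefZ coefXM mulr0 mul0r add0r.
under [RHS]eq_bigr do rewrite coefZ coefXM /= mulrAC full_momentS mulrC mulrA.
under [LHS]eq_bigr do rewrite coef_deriv.
case sp: (size p) => [|s]; first by rewrite !big_geq.
rewrite big_nat_recr //= [RHS]big_nat_recl // nth_default ?sp //.
rewrite mul0rn mul0r addr0 mulr0 mul0r add0r.
by apply: eq_bigr => i _; rewrite mulr_natr.
Qed.

(** Moving the [n] derivatives of Rodrigues' formula onto [p]. *)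
Lemma gauss_mean_hermite_poly p n :
  gauss_mean (p * hermite_poly R n) = gauss_mean p^`(n).
Proof.
elim: n p => [|n IHn] p; first by rewrite mulr1.
rewrite derivSn -IHn hermite_polyS.
have -> : p * (2 *: 'X * hermite_poly R n - (hermite_poly R n)^`())
    = 2 *: 'X * (p * hermite_poly R n) - p * (hermite_poly R n)^`() by ring.
by rewrite gauss_meanB -gauss_mean_deriv -gauss_meanB derivM addrK.
Qed.

Lemma gauss_meanC (c : R) : gauss_mean c%:P = c * Num.sqrt pi.
Proof.
rewrite (@gauss_mean_wide 1) ?size_polyC_leq1 // big_nat1 coefC.
by rewrite full_moment0.
Qed.

Lemma gauss_mean_hermite m n :
  gauss_mean (hermite_poly R m * hermite_poly R n)
  = if m == n then 2 ^+ n * n`!%:R * Num.sqrt pi else 0.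
Proof.
wlog mn : m n / (m <= n)%N => [wh|].
  have [/wh //|/ltnW nm] := leqP m n.
  by rewrite mulrC wh // eq_sym; case: eqP => [->|].
rewrite gauss_mean_hermite_poly; have [->|nmn] := eqVneq m n.
  by rewrite derivn_hermite_poly gauss_meanC.
have {}mn : (m < n)%N by rewrite ltn_neqAle nmn.
rewrite derivn_poly0; last exact: leq_trans (size_hermite_poly R m) mn.
by rewrite /gauss_mean size_poly0 big_ord0.
Qed.

Lemma conf_integral_poly_gauss a p : 0 < a -> a <= 1 ->
  let f := fun x => p.[conf_pow a x 1] * expR (- conf_pow a x 2) in
  conf_integrable a f /\ conf_integral a f = (a^-1 * gauss_mean p)%:E.
Proof.
move=> a0 a1 f.
pose F (i : 'I_(size p)) x := ((p`_i)%:E * (conf_kernel a i x)%:E)%E.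
have fE : conf_integrand a f = (fun x => \sum_(i < size p) F i x)%E.
  apply/funext => x; rewrite /conf_integrand /f horner_coef.
  rewrite [conf_pow a x 2]conf_powE.
  under [RHS]eq_bigr do rewrite /F -EFinM.
  rewrite sumEFin !mulr_suml; congr (_%:E); apply: eq_bigr => i _.
  by rewrite /conf_kernel /monomial_gauss /gauss_fun !mulrA.
have iF i : mu.-integrable setT (F i).
  by apply: integrableZl => //; exact: integrable_conf_kernel.
rewrite /conf_integrable /conf_integral fE; split; first exact: integrable_sum.
rewrite integral_sum //.
under eq_bigr => i _.
  rewrite integralZl //; last exact: integrable_conf_kernel.
  rewrite integral_conf_kernel // -EFinM mulrCA.
  over.
by rewrite sumEFin -mulr_sumr.
Qed.

End orthogonality.

(** * The identities for conformable fractional Hermite polynomials *)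

Unset Implicit Arguments.
Set Strict Implicit.

Theorem mainTheorem2 (R : realType) (a : R) (ha0 : 0 < a) (ha1 : a <= 1) :
  (* I *)
  (forall (m : nat) (x : R), 0 < x ->
     conf_hermite a m x = hermite m (x `^ a)) /\
  (* II *)
  (forall (m : nat) (x : R), (1 <= m)%N -> 0 < x ->
     conf_derivable a (conf_hermite a m) x /\
     conf_derive a (conf_hermite a m) x =
       2 * m%:R * a * conf_hermite a m.-1 x) /\
  (* III *)
  (forall m : nat,
     conf_nderivable a m (conf_hermite a m) /\
     forall x : R, 0 < x ->
       conf_deriven a m (conf_hermite a m) x = 2 ^+ m * (m`!)%:R * a ^+ m) /\
  (* IV *)
  (forall (m : nat) (x : R), (1 <= m)%N -> 0 < x ->
     conf_hermite a m.+1 x =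
       2 * x `^ a * conf_hermite a m x - 2 * m%:R * conf_hermite a m.-1 x) /\
  (* V *)
  (forall (m : nat) (x : R), 0 < x ->
     conf_derivable a (conf_hermite a m) x /\
     conf_hermite a m.+1 x =
       2 * x `^ a * conf_hermite a m x
       - a^-1 * conf_derive a (conf_hermite a m) x) /\
  (* VI *)
  (forall m : nat,
     conf_nderivable a m (fun y : R => expR (- y `^ (2 * a))) /\
     forall x : R, 0 < x ->
       conf_hermite a m x =
         (- a^-1) ^+ m * expR (x `^ (2 * a)) *
         conf_deriven a m (fun y : R => expR (- y `^ (2 * a))) x) /\
  (* VII and VIII *)
  (forall j : nat, a = (2 * j + 1)%:R^-1 ->
     (forall m n : nat, m <> n ->
        let f := fun x : R =>
          conf_hermite a m x * conf_hermite a n x * expR (- conf_pow a x 2) in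
        conf_integrable a f /\ conf_integral a f = 0%:E) /\
     (forall m n : nat, m = n ->
        let f := fun x : R =>
          conf_hermite a m x * conf_hermite a n x * expR (- conf_pow a x 2) in
        conf_integrable a f /\
        conf_integral a f = (a^-1 * 2 ^+ n * (n`!)%:R * Num.sqrt pi)%:E)).
Proof.
have powE (x : R) : 0 < x -> conf_pow a x 1 = x `^ a.
  by move=> x0; rewrite /conf_pow ltW // mul1r.
have hE m (x : R) : 0 < x -> conf_hermite a m x = (hermite_poly R m).[x `^ a].
  by move=> x0; rewrite conf_hermiteE powE.
have dH m (x : R) : 0 < x -> conf_derivable a (conf_hermite a m) x /\
    conf_derive a (conf_hermite a m) x = a * ((hermite_poly R m)^`()).[x `^ a].
  by move=> x0; exact: is_conf_derive_powR x0 (hE m) (is_derive_poly _ _).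
split; first by move=> m x x0; rewrite hE // hermiteE.
split.
  move=> [//|m] x _ x0; have [dm ->] := dH m.+1 x x0; split=> //.
  by rewrite deriv_hermite_poly hornerZ hE //; ring.
split.
  move=> m.
  have [|dm dmE] := @conf_deriven_powR R a _ _ m (hE m).
    by move=> k u; rewrite derive1n_horner; exact: derivable_horner.
  split=> // x x0; rewrite dmE // derive1n_horner derivn_hermite_poly hornerC.
  by rewrite mulrC.
split.
  move=> [//|m] x _ x0; rewrite !hE // hermite_poly_recl.
  by rewrite hornerD hornerN hornerM !hornerZ hornerX.
split.
  move=> m x x0; have [dm ->] := dH m x x0; split=> //.
  rewrite !hE // hermite_polyS hornerD hornerN hornerM hornerZ hornerX.
  by rewrite mulKf // gt_eqF.
split.
  move=> m.
  have gE (y : R) : 0 < y -> expR (- y `^ (2 * a)) = gauss_fun (y `^ a).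
    by move=> y0; rewrite /gauss_fun mulrC powRrM powR_mulrn // powR_ge0.
  have [|dm dmE] := @conf_deriven_powR R a _ _ m gE.
    exact: derivable_derive1n_gauss.
  split=> // x x0; rewrite dmE // hE // -hermiteE /hermite -/(@gauss_fun R).
  have -> : expR (x `^ (2 * a)) = expR ((x `^ a) ^+ 2).
    by rewrite mulrC powRrM powR_mulrn // powR_ge0.
  rewrite [(- a^-1) ^+ m]exprNn exprVn; field.
  by rewrite expf_neq0 // gt_eqF.
move=> j _.
have fE m n : (fun x : R =>
    conf_hermite a m x * conf_hermite a n x * expR (- conf_pow a x 2))
  = (fun x => (hermite_poly R m * hermite_poly R n).[conf_pow a x 1]
              * expR (- conf_pow a x 2)).
  by apply/funext => x; rewrite !conf_hermiteE hornerM.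
split=> m n mn f; rewrite /f fE.
  have [If ->] := conf_integral_poly_gauss (hermite_poly R m * hermite_poly R n)
    ha0 ha1.
  split=> //; rewrite gauss_mean_hermite.
  by move/eqP/negbTE: mn => ->; rewrite mulr0.
have [If ->] := conf_integral_poly_gauss (hermite_poly R m * hermite_poly R n)
  ha0 ha1.
by split=> //; rewrite gauss_mean_hermite mn eqxx !mulrA.
Qed.
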